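(* Let $m\geq 1$. The number of descending plane partitions of dimension $m$ is $$\det\left(\binom{i+j-1}{j-1}+\delta_{i,j}-\delta_{i+1,j}\right)_{1\leq i,j\leq m-1}.$$
   Context: A descending plane partition is a (possibly empty) array $\pi=(a_{i,j})$ of positive integers with rows $i=1,\dots,k$, where row $i$ is nonempty and consists of the entries $a_{i,i},a_{i,i+1},\dots,a_{i,\mu_i}$ (so $\mu_i\geq i$ and row $i$ has length $\mu_i-i+1$), such that: (1) rows are weakly decreasing: $a_{i,j}\geq a_{i,j+1}$ for $1\leq i\leq k$ and $i\leq j<\mu_i$; (2) columns are strictly decreasing: $a_{i,j}>a_{i+1,j}$ for $1\leq i\leq k-1$ and $i<j\leq\mu_{i+1}$; (3) $a_{i,i}>\mu_i-i+1$ for $1\leq i\leq k$, i.e. the first part of each row is greater than the length of that row; (4) $a_{i,i}\leq\mu_{i-1}-(i-1)+1$ for $2\leq i\leq k$, i.e. the first part of each row is at most the length of the preceding row. (These conditions imply $\mu_1\geq\mu_2\geq\cdots\geq\mu_k\geq k$.) The empty array is a descending plane partition. The parts of $\pi$ are the numbers, with repetitions, appearing in the array. $\pi$ has dimension $m$ if no part is greater than $m$ (so the count includes the empty array). Here $\delta_{x,y}$ is the Kronecker delta, and the determinant of the empty ($0\times 0$) matrix is $1$. *)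

(* Defs.v *)
From HB Require Import structures.
From mathcomp Require Import all_boot all_order all_algebra.
From mathcomp Require Import finmap.

Set Implicit Arguments.
Unset Strict Implicit.
Unset Printing Implicit Defensive.

Import GRing.Theory Num.Theory.

Local Open Scope nat_scope.

(* A shifted array is the sequence of its rows, row i (numbered from 1)      *)
(* being the sequence a_{i,i}, a_{i,i+1}, ..., a_{i,mu_i}.  Rows and columns *)
(* keep their numbering from 1; [arow], [mu] and [part] are meaningful only  *)
(* for indices inside the array.                                             *)
Definition shifted_array : Type := seq (seq nat).

Definition arow (a : shifted_array) (i : nat) : seq nat := nth [::] a (i - 1).

Definition row_len (a : shifted_array) (i : nat) : nat := size (arow a i).

(* The column of the last part of row i: row_len a i = mu_i - i + 1.         *)
Definition mu (a : shifted_array) (i : nat) : nat := i + row_len a i - 1.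

Definition part (a : shifted_array) (i j : nat) : nat :=
  nth 0 (arow a i) (j - i).

Record is_dpp (a : shifted_array) : Prop := IsDPP {
  dpp_row_nonempty : forall i, 1 <= i <= size a -> i <= mu a i;
  dpp_pos : forall i j, 1 <= i <= size a -> i <= j <= mu a i ->
    0 < part a i j;
  dpp_row_weak : forall i j, 1 <= i <= size a -> i <= j < mu a i ->
    part a i j.+1 <= part a i j;
  dpp_col_strict : forall i j, 1 <= i < size a -> i < j <= mu a i.+1 ->
    part a i.+1 j < part a i j;
  dpp_first_gt : forall i, 1 <= i <= size a -> row_len a i < part a i i;
  dpp_first_le : forall i, 2 <= i <= size a -> part a i i <= row_len a (i - 1)
}.

Definition has_dimension (m : nat) (a : shifted_array) : Prop :=
  forall i j, 1 <= i <= size a -> i <= j <= mu a i -> part a i j <= m.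

(* The indices i and j start from 1.                                         *)
Definition dpp_coef (i j : nat) : int :=
  ('C(i + j - 1, j - 1)%:Z + (i == j)%:Z - (i.+1 == j)%:Z)%R.

Definition dpp_matrix (m : nat) : 'M[int]_(m - 1) :=
  (\matrix_(i < m - 1, j < m - 1) dpp_coef i.+1 j.+1)%R.

(* Main.v *)
(* Pad every row of a descending plane partition by zeros up to one less than
   its first part.  The bound of the first part by the length of the preceding
   row becomes column strictness, and the partitions of dimension m correspond
   to a subset S of {1, ..., m-1} together with an array having, for each s in
   S, a row of natural numbers of length s and first entry s+1, rows weakly
   decreasing and shifted columns strictly decreasing.  The number of arrays
   with first entries P and lengths L is a determinant of binomial coefficients
   (a Lindstroem-Gessel-Viennot count): deleting the first entry of every row
   leaves first entries interlacing with P, and subtracting consecutive rows of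
   the determinant yields the same recursion.  For given S this is the
   principal minor on S of C = ('C(i+j, j-1)), and the sum over S is
   det (1 + C), which column operations turn into the given determinant. *)
Require Import Defs.
From mathcomp Require Import all_boot all_order all_algebra.
From mathcomp Require Import finmap zify.

Set Implicit Arguments.
Unset Strict Implicit.
Unset Printing Implicit Defensive.

Import GRing.Theory Num.Theory.

Section RowDeterminant.

Local Open Scope ring_scope.

Variables (R : comNzRingType) (k : nat).

Definition rdet (X : seq 'rV[R]_k) : R := \det (\matrix_(i < k) nth 0 X i).

Lemma rdetD (X : seq 'rV[R]_k) u v Y : (size X < k)%N ->
  rdet (X ++ (u + v) :: Y) = rdet (X ++ u :: Y) + rdet (X ++ v :: Y).
Proof.
move=> ltXk; pose i0 := Ordinal ltXk.
have rowE w : row i0 (\matrix_(i < k) nth 0 (X ++ w :: Y) i) = w.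
  by rewrite rowK nth_cat ltnn subnn.
have row'E w w' : row' i0 (\matrix_(i < k) nth 0 (X ++ w :: Y) i)
    = row' i0 (\matrix_(i < k) nth 0 (X ++ w' :: Y) i).
  apply/row_matrixP => i; apply/rowP => j; rewrite !mxE !nth_cat.
  have := neq_lift i0 i; rewrite -val_eqE /=; case: ltngtP => //= lt_i _.
  by rewrite -(subnSK lt_i).
rewrite /rdet (determinant_multilinear (i0 := i0) (b := 1) (c := 1)
  (B := \matrix_(i < k) nth 0 (X ++ u :: Y) i)
  (C := \matrix_(i < k) nth 0 (X ++ v :: Y) i)) ?mul1r //.
by rewrite !rowE !scale1r.
Qed.

Lemma rdet0 (X : seq 'rV[R]_k) Y : (size X < k)%N -> rdet (X ++ 0 :: Y) = 0.
Proof.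
move=> ltXk; apply: (addrI (rdet (X ++ 0 :: Y))).
by rewrite -rdetD // !addr0.
Qed.

Lemma rdet_sum (X : seq 'rV[R]_k) Y I (r : seq I) (F : I -> 'rV[R]_k) :
  (size X < k)%N ->
  rdet (X ++ (\sum_(i <- r) F i) :: Y) = \sum_(i <- r) rdet (X ++ F i :: Y).
Proof.
move=> ltXk; elim: r => [|i r IHr]; first by rewrite !big_nil rdet0.
by rewrite !big_cons rdetD // IHr.
Qed.

Lemma rdet_dup (X : seq 'rV[R]_k) u Y :
  ((size X).+1 < k)%N -> rdet (X ++ u :: u :: Y) = 0.
Proof.
move=> ltXk.
apply: (@determinant_alternate _ _ _ (Ordinal (ltnW ltXk)) (Ordinal ltXk)).
  by rewrite -val_eqE /= neq_ltn leqnn.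
by move=> j; rewrite !mxE !nth_cat /= ltnn subnn ltnNge leqnSn /= subSnn.
Qed.

End RowDeterminant.

Fixpoint inter (c : nat) (P : seq nat) : seq (seq nat) :=
  if P is p :: P' then
    [seq q :: Q | q <- iota c (p.+1 - c), Q <- inter p.+1 P']
  else [:: [::]].

Lemma size_inter c P Q : Q \in inter c P -> size Q = size P.
Proof.
elim: P c Q => [|p P IHP] c Q /=; first by rewrite inE => /eqP ->.
by case/allpairsPdep => q [Q' [_ /IHP sQ' ->]] /=; rewrite sQ'.
Qed.

Lemma inter_uniq c P : uniq (inter c P).
Proof.
elim: P c => [|p P IHP] c //=.
by apply: allpairs_uniq => //= [|[q Q] [q' Q'] _ _ /= [-> ->]]; first exact: iota_uniq.
Qed.

Lemma mem_inter_cons c p P q Q :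
  (q :: Q \in inter c (p :: P)) = (c <= q <= p) && (Q \in inter p.+1 P).
Proof.
apply/allpairsPdep/andP => [[q' [Q' [+ + [-> ->]]]]|[cq_p Q_in]].
  by rewrite mem_iota => ? ?; split=> //; lia.
by exists q, Q; rewrite mem_iota; split=> //; lia.
Qed.

Lemma path_inter c P (Q : seq nat) : Q \in inter c P -> all (leq c) Q /\ sorted ltn Q.
Proof.
elim: P c Q => [|p P IHP] c [|q Q] //.
rewrite mem_inter_cons => /andP[/andP[cq qp] /IHP[allQ sQ]].
split=> /=; first by rewrite cq; apply: sub_all allQ => x /=; lia.
rewrite (path_sortedE ltn_trans) sQ andbT.
by apply: sub_all allQ => x /=; lia.
Qed.

Section InterDeterminant.

Local Open Scope ring_scope.

(* Each row of partial sums is replaced by its difference with the previous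
   one, and the determinant is then expanded by multilinearity. *)
Lemma rdet_inter (R : comNzRingType) k (F : nat -> 'rV[R]_k) X c P :
    (size X + size P)%N = k -> all (leq c) P -> sorted ltn P ->
    (forall Y, (size X < k)%N -> rdet (X ++ (\sum_(0 <= q < c) F q) :: Y) = 0) ->
  rdet (X ++ [seq \sum_(0 <= q < p.+1) F q | p <- P])
    = \sum_(Q <- inter c P) rdet (X ++ [seq F q | q <- Q]).
Proof.
elim: P X c => [|p P IHP] X c /=; first by rewrite big_seq1.
move=> sXP /andP[cp _]; rewrite (path_sortedE ltn_trans) => /andP[pP sP] X0.
have ltXk : (size X < k)%N by rewrite -[ltnRHS]sXP addnS ltnS leq_addr.
rewrite -cat_rcons (IHP _ p.+1) // ?size_rcons ?addSnnS //; last first.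
  by move=> Y ltk; rewrite cat_rcons rdet_dup.
rewrite big_allpairs_dep [RHS]exchange_big /=; apply: eq_bigr => Q _.
rewrite cat_rcons (big_cat_nat (n := c)) //=; last exact: leqW.
by rewrite rdetD // X0 // add0r rdet_sum // /index_iota.
Qed.

End InterDeterminant.

(* For l > 0, the number of weakly decreasing rows of l natural numbers with
   first entry p; the value at l = 0 is 1 if p = 0 and 0 otherwise. *)
Definition cf (p l : nat) : nat := 'C((p + l).-1, p).

Lemma cf_sum p l : 0 < l -> cf p l = \sum_(0 <= q < p.+1) cf q l.-1.
Proof.
case: l => // l _; elim: p => [|p IHp].
  by rewrite big_nat1 /cf !bin0.
rewrite big_nat_recr //= -IHp /cf !addnS !addSn /= binS.
by rewrite addnC.
Qed.

Section Minors.

Local Open Scope ring_scope.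

Definition cfrow k (L : seq nat) (p : nat) : 'rV[int]_k :=
  \row_j (cf p (nth 0%N L j))%:Z.

Lemma cfrow_sum k L p : size L = k -> all (leq 1) L ->
  cfrow k L p = \sum_(0 <= q < p.+1) cfrow k (map predn L) q.
Proof.
move=> sL L1; apply/rowP => j; rewrite summxE mxE cf_sum; last first.
  by apply: (allP L1); rewrite mem_nth // sL.
rewrite (big_morph Posz PoszD (erefl _)).
by apply: eq_bigr => q _; rewrite mxE (nth_map 0%N) // sL.
Qed.

Lemma rdet_cf_step k P L : size P = k -> size L = k -> all (leq 1) L ->
    sorted ltn P ->
  rdet [seq cfrow k L p | p <- P]
    = \sum_(Q <- inter 0 P) rdet [seq cfrow k (map predn L) q | q <- Q].
Proof.
move=> sP sL L1 P_sorted.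
have {1}-> : [seq cfrow k L p | p <- P] =
  [seq \sum_(0 <= q < p.+1) cfrow k (map predn L) q | p <- P].
  by apply: eq_map => p; rewrite cfrow_sum.
apply: (rdet_inter (X := [::])) => // [|Y k0]; first by apply/allP.
by rewrite big_geq // rdet0.
Qed.

Lemma rdet_cf_drop k p P L : size P = k -> size L = k -> all (leq 1) L ->
    sorted ltn (p :: P) ->
  rdet [seq cfrow k.+1 (1%N :: L) p | p <- p :: P]
    = \sum_(Q <- inter p.+1 P) rdet [seq cfrow k (map predn L) q | q <- Q].
Proof.
move=> sP sL L1 /=; rewrite (path_sortedE ltn_trans) => /andP[pP sortP].
have cE q : cfrow k.+1 (1%N :: L) q =
    \sum_(0 <= q' < q.+1) cfrow k.+1 (0%N :: map predn L) q'.
  by rewrite cfrow_sum //= sL.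
rewrite (eq_map cE) -cat1s (rdet_inter (c := p.+1)) ?sP //; last first.
  by move=> Y lt1k; rewrite cE -[_ ++ _]/([::] ++ _) /= -[_ :: _]cat0s rdet_dup.
rewrite big_seq [RHS]big_seq; apply: eq_bigr => Q QP.
have sQ := size_inter QP; have [pQ _] := path_inter QP.
rewrite /rdet (expand_det_col _ ord0) big_ord_recl big1 => [|i _]; last first.
  rewrite !mxE /= add0n (nth_map 0%N) ?sQ ?sP // !mxE /=.
  have : (p < nth 0%N Q i)%N by apply: (allP pQ); rewrite mem_nth // sQ sP.
  by case: (nth _ _ _) => // q _; rewrite /cf addn0 bin_small // mul0r.
rewrite addr0 !mxE /= /cf addn1 binn mul1r.
rewrite /cofactor expr0 mul1r; congr (\det _).
apply/matrixP => i j; rewrite !mxE /= add0n.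
by rewrite !(nth_map 0%N) ?sQ ?sP ?mxE //.
Qed.

End Minors.

Definition zipcons (P : seq nat) (A : shifted_array) : shifted_array :=
  [seq pr.1 :: pr.2 | pr <- zip P A].

(* The arrays, listed from bottom to top, whose rows have first entries P and
   lengths L, generated by peeling off the first entry of every row. *)
Fixpoint arr (d : nat) (P L : seq nat) : seq shifted_array :=
  if d is d'.+1 then
    if (P, L) is (p :: P', 1 :: L') then
      [seq [:: p] :: zipcons P' A |
        Q <- inter p.+1 P', A <- arr d' Q (map predn L')]
    else [seq zipcons P A | Q <- inter 0 P, A <- arr d' Q (map predn L)]
  else [:: [::]].

Lemma arr_drop d p P L : arr d.+1 (p :: P) (1 :: L) =
  [seq [:: p] :: zipcons P A | Q <- inter p.+1 P, A <- arr d Q (map predn L)].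
Proof. by []. Qed.

Lemma arr_step d P L : all (leq 2) L -> arr d.+1 P L =
  [seq zipcons P A | Q <- inter 0 P, A <- arr d Q (map predn L)].
Proof. by case: P => // p P; case: L => [|[|[|l]] L]. Qed.

Definition shape_ok d (P L : seq nat) : bool :=
  [&& size P == size L, sorted ltn P, sorted ltn L & all (fun l => 0 < l <= d) L].

Lemma shape_okW d P L c Q : sorted ltn P -> sorted ltn L -> size P = size L ->
  all (fun l => 1 < l <= d.+1) L -> Q \in inter c P ->
  shape_ok d Q (map predn L).
Proof.
move=> sortP sortL sPL lL QP; have [_ sortQ] := path_inter QP.
rewrite /shape_ok size_map (size_inter QP) sPL eqxx sortQ all_map /=.
rewrite (eq_in_all (a2 := fun l => 1 < l <= d.+1)) => [|l]; last first.
  by move=> _ /=; case: l => [|[|l]].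
rewrite lL andbT (homo_sorted_in (P := leq 2) (e := ltn)) //.
  by move=> l l' /=; rewrite !unfold_in /=; lia.
by apply: sub_all lL => l /andP[].
Qed.

Variant shape_spec d : seq nat -> seq nat -> Type :=
| ShapeStep P L of size P = size L & sorted ltn P & all (fun l => 1 < l <= d.+1) L
    & (forall Q, Q \in inter 0 P -> shape_ok d Q (map predn L)) :
    shape_spec d P L
| ShapeDrop p P L of size P = size L & sorted ltn (p :: P)
    & all (fun l => 1 < l <= d.+1) L
    & (forall Q, Q \in inter p.+1 P -> shape_ok d Q (map predn L)) :
    shape_spec d (p :: P) (1 :: L).

Lemma shapeP d P L : shape_ok d.+1 P L -> shape_spec d P L.
Proof.
case/and4P => /eqP sPL sortP sortL lL.
have step : all (fun l => 1 < l <= d.+1) L -> shape_spec d P L.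
  by move=> lL2; apply: ShapeStep => // Q; apply: shape_okW.
case: L sPL sortL lL step => [|[|[|l]] L] //= sPL sortL; first by move=> _; apply.
  case: P sPL sortP => // p P [sPL] sortP lL _; have lL2 : all (fun l => 1 < l <= d.+1) L.
    apply/allP => x xL; move: (allP (order_path_min ltn_trans sortL) _ xL).
    by move: (allP lL _ xL) => /=; lia.
  apply: ShapeDrop => // Q; apply: shape_okW => //; first exact: path_sorted sortP.
  exact: path_sorted sortL.
move=> /andP[lL1 lL]; apply; rewrite lL1 /=.
apply/allP => x xL; move: (allP (order_path_min ltn_trans sortL) _ xL).
by move: (allP lL _ xL) => /=; lia.
Qed.

Lemma size_arr d P L : shape_ok d P L ->
  (size (arr d P L))%:Z%R = rdet [seq cfrow (size P) L p | p <- P].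
Proof.
elim: d P L => [|d IHd] P L.
  case/and4P => /eqP sPL _ _; case: L sPL => [|[|l] L] //= /size0nil -> _.
  by rewrite /rdet det_mx00.
have arr_sum (T : Type) (h : shifted_array -> T) r k L' :
    (forall Q, Q \in r -> size Q = k /\ shape_ok d Q L') ->
    ((size [seq h A | Q <- r, A <- arr d Q L'])%:Z
      = \sum_(Q <- r) rdet [seq cfrow k L' q | q <- Q])%R.
  move=> rP; rewrite size_allpairs_dep sumnE big_map.
  rewrite (big_morph Posz PoszD (erefl _)) big_seq [RHS]big_seq.
  by apply: eq_bigr => Q /rP[sQ /IHd ->]; rewrite sQ.
case/shapeP => [{}P {}L|p {}P {}L] sPL sortP lL stepL.
  rewrite arr_step; last by apply: sub_all lL => l /andP[].
  rewrite (arr_sum _ _ _ (size P)) ?rdet_cf_step //.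
    by apply: sub_all lL => l /andP[/ltnW].
  by move=> Q QP; rewrite (size_inter QP) stepL.
rewrite arr_drop (arr_sum _ _ _ (size P)) ?rdet_cf_drop //.
  by apply: sub_all lL => l /andP[/ltnW].
by move=> Q QP; rewrite (size_inter QP) stepL.
Qed.

Fixpoint subs (i n : nat) : seq (seq nat) :=
  if n is n'.+1 then [seq i :: s | s <- subs i.+1 n'] ++ subs i.+1 n'
  else [:: [::]].

Lemma mem_subs i n s :
  (s \in subs i n) = sorted ltn s && all (fun x => i <= x < i + n) s.
Proof.
elim: n i s => [|n IHn] i s /=.
  rewrite inE; case: s => [|x s] //=; apply/esym/negbTE; rewrite !negb_and.
  by apply/orP; right; apply/orP; left; lia.
rewrite mem_cat IHn; case: s => [|x s]; first by rewrite orbT.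
have [->|neq_xi] := eqVneq x i.
  rewrite mem_map => [|? ? [] //]; rewrite IHn /= (path_sortedE ltn_trans).
  rewrite ltnn /= andbF orbF leqnn addnS ltnS leq_addr /= -andbA andbCA.
  congr (_ && _); rewrite -all_predI; apply: eq_all => y /=; lia.
have /negbTE-> /= : x :: s \notin [seq i :: s0 | s0 <- subs i.+1 n].
  by apply/mapP => -[s' _ [/eqP]]; rewrite (negbTE neq_xi).
rewrite !(path_sortedE ltn_trans) -!andbA.
apply/and5P/and5P => -[xs ss ix xn si]; split=> //; try lia.
  by apply: sub_all si => y; lia.
apply/allP => y ys; move: (allP xs _ ys) (allP si _ ys) => /=; lia.
Qed.

Lemma subs_uniq i n : uniq (subs i n).
Proof.
elim: n i => [|n IHn] i //=.
rewrite cat_uniq IHn map_inj_uniq ?IHn /= ?andbT => [|? ? [] //].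
apply/hasPn => s; rewrite mem_subs => /andP[_ si].
apply/mapP => -[s' _ def_s]; move: si; rewrite def_s /= => /andP[]; lia.
Qed.

Section PrincipalMinors.

Local Open Scope ring_scope.

Variable R : comNzRingType.

Lemma det_add_delta n (B : 'M[R]_n.+1) i :
  \det (B + delta_mx i i) = \det B + \det (row' i (col' i B)).
Proof.
have cofE j : cofactor (B + delta_mx i i) i j = cofactor B i j.
  rewrite /cofactor; congr (_ * \det _).
  apply/matrixP => a b; rewrite !mxE.
  by have := neq_lift i a; rewrite eq_sym => /negbTE ->; rewrite addr0.
rewrite !(expand_det_row _ i) (eq_bigr (fun j =>
  B i j * cofactor B i j + (j == i)%:R * cofactor B i j)) => [|j _]; last first.
  by rewrite cofE !mxE eqxx /= mulrDl.
rewrite big_split /=; congr (_ + _).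
rewrite (bigD1 i) //= big1 => [|j /negbTE ->]; last by rewrite mul0r.
rewrite eqxx mul1r addr0 /cofactor -signr_odd oddD addbb expr0 mul1r.
by congr (\det _); apply/matrixP => a b; rewrite !mxE.
Qed.

Definition mxseq k (s : seq nat) (g : nat -> nat -> R) : 'M[R]_k :=
  \matrix_(i < k, j < k) g (nth 0%N s i) (nth 0%N s j).

Definition add1_from i (g : nat -> nat -> R) (a b : nat) : R :=
  g a b + ((a == b) && (i <= a)%N)%:R.

Lemma det_add1_from (g : nat -> nat -> R) S i n k :
    (size S + n)%N = k -> all (fun a => a < i)%N S ->
  \det (mxseq k (S ++ iota i n) (add1_from i g))
    = \sum_(T <- subs i n) \det (mxseq (size (S ++ T)) (S ++ T) g).
Proof.
elim: n S i k => [|n IHn] S i k sk Si /=.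
  rewrite big_seq1 cats0 -sk addn0; congr (\det _).
  apply/matrixP => a b; rewrite !mxE /add1_from.
  have lt_i := allP Si _ (mem_nth 0%N (ltn_ord a)).
  by rewrite leqNgt lt_i andbF addr0.
rewrite big_cat big_map /=; case: k sk => [|k] sk; first by rewrite addnS in sk.
have {}sk : (size S + n)%N = k by move: sk; rewrite addnS => -[].
have ltSk : (size S < k.+1)%N by rewrite ltnS -sk leq_addr.
pose i0 := Ordinal ltSk; set w := S ++ i :: _.
have wE j : (j < k.+1)%N -> (nth 0%N w j == i) = (j == size S).
  move=> ltjk; rewrite nth_cat; case: ltngtP => [ltj|gtj|->].
  - by rewrite ltn_eqF //; exact: (allP Si _ (mem_nth 0%N ltj)).
  - rewrite -[i :: _]/(iota i n.+1) nth_iota; last first.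
      by rewrite ltn_subLR ?addnS ?sk // ltnW.
    by rewrite -[eqbRHS]addn0 eqn_add2l subn_eq0 leqNgt gtj.
  by rewrite subnn /= eqxx.
have -> : mxseq k.+1 w (add1_from i g)
    = mxseq k.+1 w (add1_from i.+1 g) + delta_mx i0 i0.
  apply/matrixP => a b; rewrite !mxE /add1_from -addrA; congr (_ + _).
  rewrite -!val_eqE /= -!wE //; move: (nth _ _ a) (nth _ _ b) => x y.
  rewrite -natrD; congr (_%:R).
  by case: ltngtP; case: eqVneq => //=; lia.
rewrite det_add_delta; congr (_ + _).
  rewrite /w -cat_rcons IHn ?size_rcons ?addSn ?sk //.
    by apply: eq_bigr => T _; rewrite cat_rcons.
  by rewrite all_rcons ltnS leqnn; apply: sub_all Si => x /leqW.
rewrite -(IHn S i.+1 k) //; last by apply: sub_all Si => x /leqW.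
congr (\det _); apply/matrixP => a b; rewrite !mxE.
have nthw (j : 'I_k) : nth 0%N w (lift i0 j) = nth 0%N (S ++ iota i.+1 n) j.
  rewrite !nth_cat /= /bump; case: (ltnP j (size S)) => [ltj|lej].
    by rewrite add0n ltj.
  by rewrite add1n ltnNge leqW //= subSn.
by rewrite !nthw.
Qed.

Lemma det_add1 (g : nat -> nat -> R) n :
  \det (\matrix_(i < n, j < n) (g i.+1 j.+1 + (i == j)%:R))
    = \sum_(S <- subs 1 n) \det (mxseq (size S) S g).
Proof.
rewrite -(det_add1_from g (S := [::]) (k := n)) //; congr (\det _).
apply/matrixP => i j; rewrite !mxE /add1_from !nth_iota //.
by rewrite !add1n andbT eqSS.
Qed.

End PrincipalMinors.

Section DppMatrix.

Local Open Scope ring_scope.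

Lemma sum_binD a n : (\sum_(0 <= j < n.+1) 'C(a + j, j) = 'C(a + n.+1, n))%N.
Proof.
elim: n => [|n IHn]; first by rewrite big_nat1 !bin0.
by rewrite big_nat_recr //= IHn [in RHS]addnS binS addnC.
Qed.

(* Multiplication on the right by the upper unitriangular all-ones matrix
   turns delta_{i,j} - delta_{i+1,j} into the identity. *)
Lemma det_dpp_matrix m :
  \det (dpp_matrix m)
    = \det (\matrix_(i < m - 1, j < m - 1) ((cf i.+2 j.+1)%:Z + (i == j)%:R)).
Proof.
pose U : 'M[int]_(m - 1) := \matrix_(j, k) (j <= k)%N%:R.
have detU : \det U = 1.
  rewrite -det_tr det_trig; last first.
    by apply/is_trig_mxP => i j ltij; rewrite !mxE leqNgt ltij.
  by rewrite big1 // => i _; rewrite !mxE leqnn.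
rewrite -[LHS]mulr1 -detU -det_mulmx; congr (\det _).
apply/matrixP => i k; rewrite !mxE.
under eq_bigr do rewrite !mxE /dpp_coef.
have sum_le n (F : nat -> int) : (k < n)%N ->
    \sum_(j < n) F j * (j <= k)%N%:R = \sum_(0 <= j < k.+1) F j.
  move=> ltkn; rewrite big_mkord (big_ord_widen n (fun j => F j)) // [RHS]big_mkcond.
  by apply: eq_bigr => j _; rewrite ltnS; case: leqP; rewrite ?mulr1 ?mulr0.
have sum_delta c n : \sum_(0 <= j < n) (c == j)%:Z = (c < n)%N%:Z.
  elim: n => [|n IHn]; first by rewrite big_nil.
  by rewrite big_nat_recr //= IHn -PoszD ltnS; case: ltngtP.
have coefE (j : nat) : dpp_coef i.+1 j.+1
    = ('C(i.+1 + j, j))%:Z + (i == j :> nat)%:Z - (i.+1 == j)%:Z.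
  by rewrite /dpp_coef addnS !subSS !subn0 !eqSS.
rewrite (sum_le _ (fun j => dpp_coef i.+1 j.+1)) //.
rewrite (eq_bigr _ (fun j _ => coefE j)) sumrB big_split /=.
rewrite !sum_delta -(big_morph Posz PoszD (erefl _)) sum_binD -addrA.
congr (Posz _ + _).
  rewrite /cf -bin_sub; last lia.
  by congr 'C(_, _); lia.
by rewrite !ltnS -val_eqE /=; case: ltngtP.
Qed.

End DppMatrix.

(* The default value 0 makes [diag y x] fail unless y is shorter than x. *)
Definition diag (y x : seq nat) : bool :=
  all (fun t => nth 0 y t < nth 0 x t.+1) (iota 0 (size y)).

Lemma diagP y x :
  reflect (forall t, t < size y -> nth 0 y t < nth 0 x t.+1) (diag y x).
Proof.
apply: (iffP allP) => yx t; first by move=> lt_t; apply: yx; rewrite mem_iota.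
by rewrite mem_iota => /yx.
Qed.

Lemma diag_cons p x p' y :
  diag (p :: x) (p' :: y) = (p < head 0 y) && diag x y.
Proof. by rewrite /diag /= nth0 (iotaDl 1 0) all_map. Qed.

Lemma diag_size y x : 0 < size y -> diag y x -> size y < size x.
Proof.
case/lastP: y => // y z _ /diagP/(_ (size y)).
rewrite size_rcons => /(_ (ltnSn _)); rewrite ltnNge => xz; rewrite ltnNge.
by apply: contra xz => xz; rewrite [X in X <= _]nth_default.
Qed.

Definition arrok (A : shifted_array) : bool :=
  all (sorted geq) A && sorted diag A.

Definition first_ok (P : pred (seq nat)) (A : shifted_array) : bool :=
  if A is x :: _ then P x else true.

Lemma arrok_cons x A :
  arrok (x :: A) = [&& sorted geq x, first_ok (diag x) A & arrok A].
Proof.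
rewrite /arrok /= -andbA; congr (_ && _).
by case: A => //= y A; rewrite andbCA.
Qed.

Lemma inter_zipcons c P (A : shifted_array) :
    size A = size P -> all (fun x => 0 < size x) A ->
  ([seq head 0 x | x <- A] \in inter c P) && arrok A
    = first_ok (fun x => c <= head 0 x) A && arrok (zipcons P A).
Proof.
elim: P A c => [|p P IHP] [|x A] c //= [sA] /andP[x0 A0].
rewrite -[zipcons _ _]/((p :: x) :: zipcons P A) mem_inter_cons !arrok_cons.
have -> : sorted geq (p :: x) = (head 0 x <= p) && sorted geq x by case: x x0.
have -> : first_ok (diag (p :: x)) (zipcons P A)
    = first_ok (fun y => p < head 0 y) A && first_ok (diag x) A.
  by case: P A sA {IHP A0} => [|p' P] [|y A] //= _; rewrite diag_cons.
have := IHP A p.+1 sA A0.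
case: (_ \in inter p.+1 P); case: (arrok A); case: (arrok (zipcons P A));
  case: (first_ok (fun y => p < head 0 y) A) => //= _;
  by case: (c <= _); case: (_ <= p); case: (sorted geq x); case: (first_ok _ A).
Qed.

Lemma zipcons_behead (A : shifted_array) : all (fun x => 0 < size x) A ->
  zipcons [seq head 0 x | x <- A] [seq behead x | x <- A] = A.
Proof.
by elim: A => [|[|p x] A IHA] //= /IHA; rewrite /zipcons /= => ->.
Qed.

Lemma behead_zipcons P A : size A = size P ->
  [seq behead x | x <- zipcons P A] = A.
Proof.
elim: P A => [|p P IHP] [|x A] //= [/IHP]; rewrite /zipcons /=.
by move=> ->.
Qed.

Lemma head_zipcons P A : size A = size P ->
  [seq head 0 x | x <- zipcons P A] = P.
Proof.
elim: P A => [|p P IHP] [|x A] //= [/IHP]; rewrite /zipcons /=.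
by move=> ->.
Qed.

Lemma size_zipcons P A : size A = size P ->
  [seq size x | x <- zipcons P A] = [seq (size x).+1 | x <- A].
Proof.
elim: P A => [|p P IHP] [|x A] //= [/IHP]; rewrite /zipcons /=.
by move=> ->.
Qed.

Definition is_arr P L (A : shifted_array) : bool :=
  [&& [seq head 0 x | x <- A] == P, [seq size x | x <- A] == L & arrok A].

Lemma is_arr_zipcons d c P L A : size P = size L ->
    all (fun l => 1 < l <= d) L ->
  (is_arr [seq head 0 x | x <- A] (map predn L) A &&
    ([seq head 0 x | x <- A] \in inter c P))
  = [&& size A == size P, is_arr P L (zipcons P A) &
      first_ok (fun x => c <= head 0 x) A].
Proof.
move=> sPL lL; rewrite /is_arr eqxx /=; apply/idP/idP.
  case/andP=> /andP[/eqP sA okA] AP.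
  have sAP : size A = size P by rewrite -(size_map size) sA size_map.
  have A0 : all (fun x => 0 < size x) A.
    rewrite -(all_map size (ltn 0)) sA all_map.
    by apply: sub_all lL => l /=; case: l => [|[|l]].
  have := inter_zipcons c sAP A0; rewrite AP okA => /esym/andP[-> ->].
  rewrite sAP head_zipcons // size_zipcons // !eqxx /= andbT.
  have -> : [seq (size x).+1 | x <- A] = map succn (map size A) by rewrite -map_comp.
  rewrite sA -map_comp.
  rewrite andbT; apply/eqP; apply: map_id_in => l /(allP lL) /=; lia.
case/and3P => /eqP sAP /and3P[_ + okA] A1; rewrite size_zipcons // => /eqP sA.
rewrite -sA -map_comp eqxx /= andbC.
rewrite inter_zipcons ?A1 //; apply/allP => x xA.
by have := allP lL (size x).+1; rewrite -sA => /(_ (map_f _ xA)) /andP[].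
Qed.

Lemma is_arr_behead d c P L A (A' := [seq behead x | x <- A]) :
    size P = size L -> all (fun l => 1 < l <= d) L -> is_arr P L A ->
    first_ok (fun x => c <= head 0 x) A' ->
  [/\ zipcons P A' = A, is_arr [seq head 0 x | x <- A'] (map predn L) A'
    & [seq head 0 x | x <- A'] \in inter c P].
Proof.
move=> sPL lL Aok A'c; have /and3P[/eqP hA /eqP sA _] := Aok.
have zipA : zipcons P A' = A.
  rewrite -hA zipcons_behead // -(all_map size (ltn 0)) sA.
  by apply: sub_all lL => l /=; case: l.
have := is_arr_zipcons c A' sPL lL; rewrite zipA Aok A'c.
by rewrite size_map -hA size_map eqxx => /andP[].
Qed.

Lemma mem_arr d P L A : shape_ok d P L -> (A \in arr d P L) = is_arr P L A.
Proof.
elim: d P L A => [|d IHd] P L A.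
  case/and4P => /eqP sPL _ _; case: L sPL => [|[|l] L] //= /size0nil -> _.
  by rewrite inE /is_arr; case: A.
case/shapeP => [{}P {}L|p {}P {}L] sPL sortP lL stepL.
  rewrite arr_step; last by apply: sub_all lL => l /andP[].
  apply/allpairsPdep/idP => [[Q [A' [QP + ->]]]|].
    rewrite IHd ?stepL // => /[dup] /and3P[/eqP QA' _ _] A'ok.
    have := is_arr_zipcons 0 A' sPL lL; rewrite QA' A'ok QP.
    by case/esym/and3P.
  move=> Aok; have [|zipA A'ok A'P] := is_arr_behead (c := 0) sPL lL Aok.
    by case: (A).
  exists [seq head 0 x | x <- [seq behead x | x <- A]], [seq behead x | x <- A].
  by rewrite zipA; split=> //; rewrite IHd ?stepL.
rewrite arr_drop; apply/allpairsPdep/idP => [[Q [A' [QP + ->]]]|].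
  rewrite IHd ?stepL // => /[dup] /and3P[/eqP QA' _ _] A'ok.
  have := is_arr_zipcons p.+1 A' sPL lL; rewrite QA' A'ok QP.
  case/esym/and3P => /eqP sA' /and3P[/eqP hA /eqP sA okA] A1.
  rewrite /is_arr /= hA sA !eqxx arrok_cons okA andbT /=.
  case: P A' sA' A1 {sPL sortP stepL QP QA' A'ok hA sA okA} => [|p' P] [|x A'] //= _.
  by rewrite diag_cons /diag andbT.
case: A => [|x A] //; rewrite /is_arr /= arrok_cons !eqseq_cons -!andbA.
case/and5P => /eqP hx hA /eqP sx sA /and3P[_ A1 okA].
have {hx sx} xE : x = [:: p] by case: x hx sx {A1} => [|? []] //= ->.
have Aok : is_arr P L A by apply/and3P.
have [|zipA A'ok A'P] := is_arr_behead (c := p.+1) sPL lL Aok.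
  by move: A1; rewrite xE; case: (A) => [|[|? y] ?] //=; rewrite diag_cons => /andP[].
exists [seq head 0 x | x <- [seq behead x | x <- A]], [seq behead x | x <- A].
by rewrite zipA xE; split=> //; rewrite IHd ?stepL.
Qed.

Lemma arr_uniq d P L : shape_ok d P L -> uniq (arr d P L).
Proof.
elim: d P L => [|d IHd] P L //.
have pairs_uniq (r : seq (seq nat)) (L' : seq nat) (h : shifted_array -> shifted_array) k :
    uniq r -> (forall Q, Q \in r -> size Q = k /\ shape_ok d Q L') ->
    {in [pred A : shifted_array | size A == k] &, injective h} ->
    uniq [seq h A | Q <- r, A <- arr d Q L'].
  move=> r_uniq rP h_inj; apply: allpairs_uniq_dep => //.
    by move=> Q /rP[_ /IHd].
  move=> _ _ /allpairsPdep[Q [A [Qr QA ->]]] /allpairsPdep[Q' [A' [Q'r Q'A' ->]]] /=.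
  have [[sQ Qok] [sQ' Q'ok]] := (rP _ Qr, rP _ Q'r).
  move: QA Q'A'; rewrite !mem_arr // => /and3P[/eqP hA _ _] /and3P[/eqP hA' _ _].
  move=> /h_inj eqA; have {}eqA : A = A'.
    by apply: eqA; rewrite inE -(size_map (head 0)) ?hA ?hA' ?sQ ?sQ'.
  by rewrite -hA -hA' eqA.
have zip_inj R : {in [pred A : shifted_array | size A == size R] &, injective (zipcons R)}.
  move=> A A' /eqP sA /eqP sA' eqAA'.
  by rewrite -(behead_zipcons sA) eqAA' behead_zipcons.
case/shapeP => [{}P {}L|p {}P {}L] _ _ lL stepL.
  rewrite arr_step; last by apply: sub_all lL => l /andP[].
  apply: (pairs_uniq _ _ _ (size P)) => //; first exact: inter_uniq.
  by move=> Q QP; rewrite (size_inter QP) stepL.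
rewrite arr_drop.
apply: (pairs_uniq _ _ _ (size P)); first exact: inter_uniq.
  by move=> Q QP; rewrite (size_inter QP) stepL.
by move=> A A' sA sA' [] /zip_inj; apply.
Qed.

Definition row_ok m (x : seq nat) : bool :=
  [&& 0 < size x, sorted geq x, all (ltn 0) x, size x < head 0 x & head 0 x <= m].

Definition adj (y x : seq nat) : bool := (head 0 y <= size x) && diag y x.

Lemma geq_trans : transitive geq.
Proof. by move=> x y z /= yx zy; apply: leq_trans zy yx. Qed.

Lemma is_dppP m (a : shifted_array) :
  is_dpp a /\ has_dimension m a
    <-> all (row_ok m) a && sorted (fun x y => adj y x) a.
Proof.
have arowE k : arow a k.+1 = nth [::] a k by rewrite /arow subn1.
have partE k t : part a k.+1 (t + k.+1) = nth 0 (nth [::] a k) t.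
  by rewrite /part addnK arowE.
have muE k : mu a k.+1 = size (nth [::] a k) + k.
  by rewrite /mu /row_len arowE; lia.
split.
  case=> -[ne pos weak strict gt le] dim; apply/andP; split.
    apply/(all_nthP [::]) => k ltk; rewrite /row_ok -nth0.
    have k1 : 1 <= k.+1 <= size a by [].
    have szk : 0 < size (nth [::] a k) by have := ne _ k1; rewrite muE; lia.
    apply/and5P; split=> //.
    - apply/(sortedP 0) => t ltt; rewrite /= -!partE addSn.
      by apply: weak => //; rewrite muE; lia.
    - apply/(all_nthP 0) => t ltt /=; rewrite -partE.
      by apply: pos => //; rewrite muE; lia.
    - by have := gt _ k1; rewrite -[X in part _ _ X]add0n partE /row_len arowE.
    by rewrite -partE; apply: dim => //; rewrite muE; lia.
  apply/(sortedP [::]) => k ltk; apply/andP; split.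
    by have := le k.+2; rewrite -[X in part _ _ X]add0n partE /row_len subn1 arowE nth0; apply.
  apply/diagP => t ltt; rewrite -!partE addSn -addnS.
  by apply: strict => //; rewrite muE; lia.
case/andP => /(all_nthP [::]) rows /(sortedP [::]) adjs.
have row k : 1 <= k <= size a -> row_ok m (nth [::] a k.-1) by case: k => // k; apply: rows.
have idx i j : i <= j -> j = (j - i) + i by lia.
split; first split.
- by case=> // k /row /and5P[szk _ _ _ _]; rewrite muE -[k.+1]add1n leq_add2r.
- case=> // k j /row /and5P[_ _ /(all_nthP 0) posk _ _] /andP[le_j]; rewrite muE.
  by rewrite (idx _ _ le_j) partE => ltj; apply: posk => /=; lia.
- case=> // k j /row /and5P[_ /(sortedP 0) sk _ _ _] /andP[le_j]; rewrite muE.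
  by rewrite (idx _ _ le_j) -addSn !partE => ltj; apply: sk => /=; lia.
- case=> // k j /andP[_ ltk] /andP[le_j]; rewrite muE.
  have /andP[_ /diagP dk] := adjs _ ltk.
  by rewrite (idx _ _ le_j) partE addnS -addSn partE => ltj; apply: dk; lia.
- case=> // k /row /and5P[_ _ _ + _]; rewrite -[X in part _ _ X]add0n partE nth0.
  by rewrite /row_len arowE.
- case=> [|[|k]] // /andP[_ ltk]; have /andP[+ _] := adjs _ ltk.
  by rewrite -[X in part _ _ X]add0n partE nth0 /row_len subn1 arowE.
case=> // k j /row /and5P[_ sk _ _ le_m] /andP[le_j]; rewrite muE (idx _ _ le_j) partE.
move=> ltj; apply: leq_trans le_m; rewrite -nth0 /=.
have geq_refl : reflexive geq by move=> x /=.
by apply: (sorted_leq_nth geq_trans geq_refl 0 sk) => //; rewrite inE /=; lia.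
Qed.

(* Padding every row by zeros up to one less than its first part turns the
   condition that this first part is at most the length of the preceding row
   into the strictness of the columns. *)
Definition pad (x : seq nat) : seq nat := x ++ nseq ((head 0 x).-1 - size x) 0.

Definition strip (x : seq nat) : seq nat := filter (ltn 0) x.

Definition padrow n (x : seq nat) : bool :=
  [&& 0 < size x <= n, head 0 x == (size x).+1 & sorted geq x].

Lemma stripE x : sorted geq x -> x = strip x ++ nseq (size x - size (strip x)) 0.
Proof.
elim: x => //= p x IHx px; have := IHx (path_sorted px).
case: p px => [|p] px /=; last by rewrite subSS => {1}->.
have /all_pred1P x0 : all (pred1 0) x.
  by apply: sub_all (order_path_min geq_trans px) => q /=; rewrite leqn0.
have -> : strip x = [::] by rewrite x0 /strip filter_nseq.
by rewrite /= => {1}->; rewrite subn0.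
Qed.

Lemma head_strip x : 0 < head 0 x -> head 0 (strip x) = head 0 x.
Proof. by case: x => [|[]]. Qed.

Lemma pad_strip n x : padrow n x -> pad (strip x) = x.
Proof.
case/and3P => _ /eqP hx sx.
by rewrite /pad head_strip hx //= -stripE.
Qed.

Lemma strip_pad m x : row_ok m x -> strip (pad x) = x.
Proof.
case/and5P => _ _ /all_filterP x0 _ _; rewrite /strip filter_cat x0.
by rewrite (_ : filter _ (nseq _ _) = [::]) ?cats0 ?filter_nseq.
Qed.

Lemma nth_pad x t : nth 0 (pad x) t = nth 0 x t.
Proof.
by rewrite nth_cat nth_nseq if_same; case: ltnP => // /(nth_default 0) ->.
Qed.

Lemma size_pad x : size x < head 0 x -> size (pad x) = (head 0 x).-1.
Proof. by rewrite size_cat size_nseq; lia. Qed.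

Lemma padrow_pad n x : row_ok n.+1 x -> padrow n (pad x).
Proof.
case/and5P => x0 sx _ lt_x xn.
have hx : head 0 (pad x) = head 0 x by rewrite -!nth0 nth_pad.
rewrite /padrow hx size_pad //; apply/and3P; split; try lia.
rewrite /pad; move: (_ - _) => k; case: x x0 sx {lt_x xn hx} => //= p x _ px.
rewrite cat_path px; case: k => //= k.
by elim: k.
Qed.

Lemma row_ok_strip n x : padrow n x -> row_ok n.+1 (strip x).
Proof.
case/and3P => /andP[x0 xn] /eqP hx sx.
have hs : head 0 (strip x) = (size x).+1 by rewrite head_strip hx.
rewrite /row_ok hs !ltnS xn filter_all size_filter count_size.
rewrite (sorted_filter geq_trans) //= andbT.
by rewrite -size_filter; move: hs; rewrite /strip; case: filter.
Qed.

Lemma diag_pad m y x : row_ok m y -> row_ok m x ->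
  diag (pad y) (pad x) = adj y x.
Proof.
case/and5P => y0 _ _ lt_y _ /and5P[_ _ /(all_nthP 0) x_gt0 _ _].
have nth_gt0 t : (0 < nth 0 x t) = (t < size x).
  by case: (ltnP t (size x)) => [/x_gt0|/(nth_default 0) ->].
apply/diagP/andP => [yx|[le_yx /diagP yx] t].
  have {}yx t : t < (head 0 y).-1 -> nth 0 y t < nth 0 x t.+1.
    by rewrite -size_pad // => /yx; rewrite !nth_pad.
  split; last by apply/diagP => t ltt; apply: yx; lia.
  have := yx (head 0 y).-2; case: (head 0 y) lt_y => [|[|h]] //; first lia.
  by move=> _ /(_ (ltnSn _)) /(leq_ltn_trans (leq0n _)); rewrite nth_gt0.
rewrite size_pad // !nth_pad => ltt; case: (ltnP t (size y)) => [/yx //|le_t].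
by rewrite [nth 0 y t]nth_default // nth_gt0; lia.
Qed.

Definition padded_arrays n : seq shifted_array :=
  [seq A | s <- subs 1 n, A <- arr n (map succn s) s].

Lemma shape_ok_subs n S : S \in subs 1 n -> shape_ok n (map succn S) S.
Proof.
rewrite mem_subs => /andP[sortS Sn].
rewrite /shape_ok size_map eqxx sorted_map sortS; apply: sub_all Sn => x /=; lia.
Qed.

Lemma mem_padded_arrays n A :
  (A \in padded_arrays n) = all (padrow n) A && sorted diag A.
Proof.
apply/allpairsPdep/andP => [[S [A' [Sn + ->]]]|[rowA diagA]].
  rewrite mem_arr ?shape_ok_subs // => /and3P[/eqP hA /eqP sA /andP[sortA diagA]].
  split=> //; apply/allP => x xA; rewrite /padrow (allP sortA) // andbT.
  have := Sn; rewrite mem_subs => /andP[_ /allP/(_ (size x))].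
  rewrite -sA map_f // => /(_ isT) /andP[x0 xn].
  rewrite x0 -ltnS -add1n xn /=; apply/eqP.
  have : map (head 0) A' = map (fun x => (size x).+1) A' by rewrite hA -sA -map_comp.
  by move/eq_in_map => ->.
have diag_sizes : sorted ltn (map size A).
  rewrite (homo_sorted_in (P := fun x => 0 < size x) (e := diag)) //.
    by move=> y x y0 _; apply: diag_size.
  by apply: sub_all rowA => x /and3P[/andP[]].
have sS : map size A \in subs 1 n.
  rewrite mem_subs diag_sizes all_map.
  by apply: sub_all rowA => x /and3P[/andP[x0 xn] _ _] /=; lia.
exists (map size A), A; split=> //; rewrite mem_arr ?shape_ok_subs //.
rewrite /is_arr eqxx /arrok diagA -map_comp andbT /=; apply/andP; split.
  by apply/eqP/eq_in_map => x /(allP rowA) /and3P[_ /eqP].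
by apply: sub_all rowA => x /and3P[].
Qed.

Lemma padded_arrays_uniq n : uniq (padded_arrays n).
Proof.
apply: allpairs_uniq_dep => [|S Sn|]; first exact: subs_uniq.
  by rewrite arr_uniq ?shape_ok_subs.
move=> _ _ /allpairsPdep[S [A [Sn AS ->]]] /allpairsPdep[S' [A' [S'n A'S' ->]]] /=.
move: AS A'S'; rewrite !mem_arr ?shape_ok_subs //.
by move=> /and3P[_ /eqP <- _] /and3P[_ /eqP <- _] ->.
Qed.

Lemma size_padded_arrays m : 0 < m ->
  (size (padded_arrays (m - 1)))%:Z%R = (\det (dpp_matrix m))%R.
Proof.
move=> m0; rewrite det_dpp_matrix (det_add1 (fun a b => (cf a.+1 b)%:Z%R)).
rewrite size_allpairs_dep sumnE big_map (big_morph Posz PoszD (erefl _)).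
rewrite big_seq [RHS]big_seq; apply: eq_bigr => S Sn.
rewrite size_arr ?shape_ok_subs // size_map; congr (\det _)%R.
apply/matrixP => i j; rewrite !mxE -map_comp.
by rewrite (nth_map 0) ?mxE.
Qed.

Definition dpps n : seq shifted_array :=
  [seq rev (map strip A) | A <- padded_arrays n].

Lemma dpps_uniq n : uniq (dpps n).
Proof.
rewrite map_inj_in_uniq ?padded_arrays_uniq // => A A'.
rewrite !mem_padded_arrays => /andP[rowA _] /andP[rowA' _] /(can_inj revK) eqAA'.
have padK B : all (padrow n) B -> map pad (map strip B) = B.
  by move=> /allP rowB; rewrite -map_comp; apply: map_id_in => x /rowB /pad_strip.
by rewrite -(padK A) // eqAA' padK.
Qed.

Lemma mem_dpps n a : a \in dpps n <-> is_dpp a /\ has_dimension n.+1 a.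
Proof.
rewrite is_dppP; split=> [/mapP[A + ->]|].
  rewrite mem_padded_arrays all_rev rev_sorted => /andP[rowA diagA].
  rewrite all_map (homo_sorted_in (P := padrow n) (e := diag)) ?andbT //.
    by apply: sub_all rowA => x /row_ok_strip.
  move=> y x rowy rowx; rewrite -{1}(pad_strip rowy) -{1}(pad_strip rowx).
  by rewrite (diag_pad (row_ok_strip rowy) (row_ok_strip rowx)).
rewrite -[in sorted _ a](revK a) rev_sorted -all_rev => /andP[rowa adja].
apply/mapP; exists (map pad (rev a)).
  rewrite mem_padded_arrays all_map.
  rewrite (homo_sorted_in (P := row_ok n.+1) (e := adj)) ?andbT //.
    by apply: sub_all rowa => x /padrow_pad.
  by move=> y x rowy rowx; rewrite (diag_pad rowy rowx).
rewrite -map_comp map_id_in ?revK // => x /(allP rowa); exact: strip_pad.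
Qed.

Theorem corollary7 (m : nat) (hm : (1 <= m)%N) :
  exists2 S : {fset shifted_array},
    (forall a : shifted_array, a \in S <-> is_dpp a /\ has_dimension m a) &
    (#|` S|%fset%:Z = \det (dpp_matrix m))%R.
Proof.
exists (seq_fset tt (dpps (m - 1))) => [a|].
  by rewrite seq_fsetE mem_dpps subn1 prednK.
by rewrite size_seq_fset undup_id ?dpps_uniq // size_map size_padded_arrays.
Qed.
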